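(* Let $V$ be a non-zero finite-dimensional real $\mathbb{Z}$-graded vector space with $r_j=\dim V_j$, equipped with a degree $\ell$ metric $g$ with $\ell$ odd, and write $\ell=-2k+1$. Let $i_\bullet\in\mathbb{N}_0$ be such that $r_{k+i_\bullet}\ne0$ and $r_{k+i}=0$ for all $i>i_\bullet$. For $A\in\mathrm{O}(V_\bullet,g)$ and $i\in\{0,\dots,i_\bullet\}$ let $\mathbb{A}_{(i)}\in\mathrm{GL}(r_{k+i},\mathbb{R})$ be the matrix of $A_{k+i}:V_{k+i}\to V_{k+i}$ with respect to the basis of $V_{k+i}$ taken from the standard total basis described in the context. Then the map $A\mapsto(\mathbb{A}_{(i)})_{i=0}^{i_\bullet}$ defines a Lie group isomorphism $$\mathrm{O}(V_\bullet,g)\cong\prod_{i=0}^{i_\bullet}\mathrm{GL}(r_{k+i},\mathbb{R}).$$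
   Context: A graded vector space is a sequence $V=(V_j)_{j\in\mathbb{Z}}$ of real vector spaces with $\sum_j\dim V_j<\infty$. $V^*$ is the graded dual, $(V^* )_j=(V_{-j})^*$. A degree $\ell$ metric on $V$ is a bilinear map $g:V\times V\to\mathbb{R}$ with $g(v,w)=0$ unless $|v|+|w|+\ell=0$, $g(v,w)=(-1)^{(|v|+\ell)(|w|+\ell)}g(w,v)$, and such that the degree $\ell$ map $g:V\to V^*$ (same symbol), $[g(v)](w):=(-1)^{(|v|+1)\ell}g(v,w)$, is an isomorphism, i.e. all components $g_j:V_j\to(V_{-(j+\ell)})^*$ are isomorphisms. Hence $r_j=r_{-(j+\ell)}$ for all $j$. $\mathrm{GL}(V_\bullet)\cong\prod_j\mathrm{GL}(V_j)$ is the Lie group of invertible degree zero linear maps $A=(A_j)_{j\in\mathbb{Z}}$ of $V$, and $\mathrm{O}(V_\bullet,g)=\{A\in\mathrm{GL}(V_\bullet)\mid A^TgA=g\}$, i.e. $(A_{-(j+\ell)})^Tg_jA_j=g_j$ for all $j$ (it is the underlying Lie group of the graded orthogonal group $\mathrm{O}(V,g)$). Standard total basis: for $\ell=-2k+1$, a total basis (union of bases of the $V_j$) of $V$ of the form $\bigcup_{i=0}^{i_\bullet}(t^{(i)}_{\alpha})_{\alpha=1}^{r_{k+i}}\cup\bigcup_{i=0}^{i_\bullet}(\overline{t}^{(i)}_{\beta})_{\beta=1}^{r_{k+i}}$, where $(t^{(i)}_\alpha)_\alpha$ is a basis of $V_{k+i}$, $(\overline{t}^{(i)}_\beta)_\beta$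 is a basis of $V_{k-(i+1)}$, $g(t^{(i)}_\alpha,\overline{t}^{(i)}_\beta)=\delta_{\alpha\beta}$, and all other values of $g$ on basis vectors are zero or obtained by graded symmetry. Such a basis exists and one is fixed. The matrix is defined by $A_{k+i}(t^{(i)}_\alpha)=\sum_\beta[\mathbb{A}_{(i)}]^\beta{}_\alpha t^{(i)}_\beta$. $\mathrm{GL}(0,\mathbb{R})$ is the trivial group. *)

(* Defs.v *)
From HB Require Import structures.
From mathcomp Require Import all_boot all_order all_algebra.
From mathcomp Require Import all_classical all_reals all_analysis.

Set Implicit Arguments.
Unset Strict Implicit.
Unset Printing Implicit Defensive.

Import Order.TTheory GRing.Theory Num.Theory.
Import numFieldNormedType.Exports.

Local Open Scope classical_set_scope.
Local Open Scope ring_scope.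

(* Families (x_i)_i of vectors with pointwise operations; the alias is there
   because the library only has these instances for non-dependent functions. *)
Definition family (R : realType) (I : Type) (E : I -> lmodType R) : Type :=
  forall i, E i.

Section FamilyLmodule.
Context {R : realType} {I : Type} (E : I -> lmodType R).
Implicit Types x y z : family E.

HB.instance Definition _ := gen_eqMixin (family E).
HB.instance Definition _ := gen_choiceMixin (family E).

Definition family_zero : family E := fun=> 0.
Definition family_add x y : family E := fun i => x i + y i.
Definition family_opp x : family E := fun i => - x i.
Definition family_scale (a : R) x : family E := fun i => a *: x i.

Fact family_addA : associative family_add.
Proof. by move=> x y z; apply: functional_extensionality_dep => i; apply: addrA. Qed.
Fact family_addC : commutative family_add.
Proof. by move=> x y; apply: functional_extensionality_dep => i; apply: addrC. Qed.
Fact family_add0 : left_id family_zero family_add.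
Proof. by move=> x; apply: functional_extensionality_dep => i; apply: add0r. Qed.
Fact family_addN : left_inverse family_zero family_opp family_add.
Proof. by move=> x; apply: functional_extensionality_dep => i; apply: addNr. Qed.

HB.instance Definition _ := GRing.isZmodule.Build (family E)
  family_addA family_addC family_add0 family_addN.

Fact family_scaleA a b x :
  family_scale a (family_scale b x) = family_scale (a * b) x.
Proof. by apply: functional_extensionality_dep => i; apply: scalerA. Qed.
Fact family_scale1 : left_id 1 family_scale.
Proof. by move=> x; apply: functional_extensionality_dep => i; apply: scale1r. Qed.
Fact family_scaleDr : right_distributive family_scale +%R.
Proof.
by move=> a x y; apply: functional_extensionality_dep => i; apply: scalerDr.
Qed.
Fact family_scaleDl x : {morph family_scale^~ x : a b / a + b}.
Proof. by move=> a b; apply: functional_extensionality_dep => i; apply: scalerDl. Qed.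

HB.instance Definition _ := GRing.Zmodule_isLmodule.Build R (family E)
  family_scaleA family_scale1 family_scaleDr family_scaleDl.

End FamilyLmodule.

Section Smoothness.
Context {R : realType}.

(* C^k on an open set of a finite-dimensional space: all iterated directional
   derivatives up to order k exist and are continuous there. *)
Fixpoint Ck (n m k : nat) (U : set 'rV[R]_n) (f : 'rV[R]_n -> 'rV[R]_m) : Prop :=
  if k is k'.+1 then
    (forall x, U x -> differentiable f x) /\ (forall v, Ck k' U ('D_v f))
  else forall x, U x -> {for x, continuous f}.

Definition Cinfty n m (U : set 'rV[R]_n) (f : 'rV[R]_n -> 'rV[R]_m) : Prop :=
  forall k, Ck k U f.

(* A finite-dimensional real vector space carries the smooth structure (and the
   topology) of R^n transported along a linear isomorphism.  The choice of the
   isomorphism is immaterial, so the definitions below just ask for one. *)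

Definition lin_open (X : lmodType R) (O : set X) : Prop :=
  exists n (c : {linear X -> 'rV[R]_n}), bijective c /\ open (c @` O).

(* Smoothness of a map on an arbitrary subset of a finite-dimensional space:
   locally it extends to a C^oo map on an open set of the ambient space.  On
   embedded submanifolds this is smoothness for the submanifold structures. *)
Definition smooth_on (X Y : lmodType R) (S : set X) (f : X -> Y) : Prop :=
  exists n m (c : {linear X -> 'rV[R]_n}) (d : {linear Y -> 'rV[R]_m}),
    [/\ bijective c, bijective d &
      forall x, S x -> exists (U : set 'rV[R]_n) (h : 'rV[R]_n -> 'rV[R]_m),
        [/\ open U, U (c x), Cinfty U h &
            forall y, S y -> U (c y) -> d (f y) = h (c y)]].

Definition diffeomorphism (X Y : lmodType R) (S : set X) (T : set Y)
    (f : X -> Y) : Prop :=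
  [/\ set_bij S T f, smooth_on S f &
      exists2 h : Y -> X, smooth_on T h & forall x, S x -> h (f x) = x].

Definition submanifold (X : lmodType R) (m : nat) (S : set X) : Prop :=
  forall x, S x -> exists (O : set X) (U : set 'rV[R]_m) (f : X -> 'rV[R]_m),
    [/\ lin_open O, O x, open U & diffeomorphism (S `&` O) U f].

End Smoothness.

(* A group whose elements are points of a real vector space; gmul and ginv are
   only meaningful on the carrier. *)
Record embedded_group (R : realType) := EmbeddedGroup {
  ambient : lmodType R;
  carrier : set ambient;
  gmul : ambient -> ambient -> ambient;
  gone : ambient;
  ginv : ambient -> ambient }.

Arguments carrier {R} G : rename.
Arguments gmul {R} G : rename.
Arguments gone {R} G : rename.
Arguments ginv {R} G : rename.

Section LieGroups.
Context {R : realType}.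
Implicit Types G H : embedded_group R.

Record is_group G : Prop := IsGroup {
  group_one : carrier G (gone G);
  group_mul : forall x y, carrier G x -> carrier G y -> carrier G (gmul G x y);
  group_inv : forall x, carrier G x -> carrier G (ginv G x);
  group_mulA : forall x y z, carrier G x -> carrier G y -> carrier G z ->
    gmul G x (gmul G y z) = gmul G (gmul G x y) z;
  group_mul1 : forall x, carrier G x -> gmul G x (gone G) = x;
  group_1mul : forall x, carrier G x -> gmul G (gone G) x = x;
  group_mulV : forall x, carrier G x -> gmul G x (ginv G x) = gone G;
  group_Vmul : forall x, carrier G x -> gmul G (ginv G x) x = gone G }.

Record is_lie_group G : Prop := IsLieGroup {
  lie_group : is_group G;
  lie_submanifold : exists m, submanifold m (carrier G);
  lie_mul : smooth_on (carrier G `*` carrier G) (fun p => gmul G p.1 p.2);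
  lie_inv : smooth_on (carrier G) (ginv G) }.

Record lie_group_isomorphism G H (f : ambient G -> ambient H) : Prop :=
  LieGroupIsomorphism {
    lie_iso_source : is_lie_group G;
    lie_iso_target : is_lie_group H;
    lie_iso_morphism : forall x y, carrier G x -> carrier G y ->
      f (gmul G x y) = gmul H (f x) (f y);
    lie_iso_diffeo : diffeomorphism (carrier G) (carrier H) f }.

Definition prod_GL (I : Type) (r : I -> nat) : embedded_group R :=
  @EmbeddedGroup R (family (fun i => 'M[R]_(r i) : lmodType R))
    [set M | forall i, M i \in unitmx]
    (fun M N i => M i *m N i)
    (fun i => 1%:M)
    (fun M i => invmx (M i)).

End LieGroups.

Arguments lie_group_isomorphism {R} G H f.

Record graded_space (R : realType) := GradedSpace {
  component :> int -> vectType R;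
  finite_total_dim : finite_set [set j | dim (component j) != 0%N] }.

Section GradedSpaces.
Context {R : realType} (V : graded_space R).

Definition gdim (j : int) : nat := dim (V j).

Definition gdual (j : int) : vectType R := 'Hom(V (- j), R^o).

Definition End0 : lmodType R := family (fun j => 'End(V j) : lmodType R).

Definition GL0 : set End0 := [set A | forall j, bijective (A j)].

Definition transpose (A : End0) (j : int) (xi : gdual j) : gdual j :=
  (xi \o A (- j))%VF.

(* The homogeneous components V_i x V_j -> R of a bilinear map V x V -> R. *)
Definition gbilinear := forall i j, 'Hom(V i, 'Hom(V j, R^o)).

Definition gflat (l : int) (g : gbilinear) (j : int) (v : V j) : gdual (j + l) :=
  (-1) ^ ((j + 1) * l) *: g j (- (j + l)) v.

Record is_metric (l : int) (g : gbilinear) : Prop := IsMetric {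
  metric_degree : forall i j (v : V i) (w : V j), i + j + l != 0 -> g i j v w = 0;
  metric_sym : forall i j (v : V i) (w : V j),
    g i j v w = (-1) ^ ((i + l) * (j + l)) * g j i w v;
  metric_nondeg : forall j, bijective (gflat l g (j := j)) }.

Definition orthogonal0 (l : int) (g : gbilinear) : set End0 :=
  [set A | GL0 A /\
    forall j v, transpose A (gflat l g (A j v)) = gflat l g v].

Definition orthogonal_group (l : int) (g : gbilinear) : embedded_group R :=
  @EmbeddedGroup R End0 (orthogonal0 l g)
    (fun A B j => (A j \o B j)%VF)
    (fun j => \1%VF)
    (fun A j => (A j)^-1%VF).

(* The degree is -2k+1; i runs over 0, ..., n, with t i a basis of V_{k+i} and
   tb i a basis of V_{k-(i+1)}, both indexed by 1, ..., r_{k+i}. *)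
Record is_standard_basis (g : gbilinear) (k : int) (n : nat)
    (t : forall i : 'I_n.+1, (gdim (k + i%:Z)).-tuple (V (k + i%:Z)))
    (tb : forall i : 'I_n.+1, (gdim (k + i%:Z)).-tuple (V (k - (i%:Z + 1)))) :
    Prop := IsStandardBasis {
  std_basis_t : forall i, basis_of fullv (t i);
  std_basis_tb : forall i, basis_of fullv (tb i);
  std_total : forall j, gdim j != 0%N ->
    exists i : 'I_n.+1, j = k + i%:Z \/ j = k - (i%:Z + 1);
  std_t_tb : forall i i' a b,
    g _ _ (tnth (t i) a) (tnth (tb i') b) =
      ((i == i') && (a == b :> nat))%:R;
  std_t_t : forall i i' a b, g _ _ (tnth (t i) a) (tnth (t i') b) = 0;
  std_tb_tb : forall i i' a b, g _ _ (tnth (tb i) a) (tnth (tb i') b) = 0 }.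

(* A(t_a) = \sum_b M b a *: t_b *)
Definition matrix_in (j : int) (s : (gdim j).-tuple (V j)) (A : 'End(V j)) :
    'M[R]_(gdim j) :=
  \matrix_(b, a) coord s b (A (tnth s a)).

End GradedSpaces.

(* Main.v *)
(* Write M_i and N_i for the matrices of A on V_{k+i} and on V_{k-(i+1)} in the
   standard basis.  For degree reasons g only pairs V_{k+i} with V_{k-(i+1)}, so
   A is orthogonal iff M_i^T N_i = 1 for all i.  Hence the N_i = (M_i^{-1})^T are
   determined by the M_i, which can be arbitrary invertible matrices.  The map
   A |-> (M_i) is linear, and its inverse is smooth because matrix inversion is
   a rational map (Cramer).  The diffeomorphism with an open subset of R^m makes
   the orthogonal group a submanifold; its product is bilinear, and its inversion
   is the restriction of the linear map (M, N) |-> (N^T, M^T). *)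
Require Import Defs.
From HB Require Import structures.
From mathcomp Require Import all_boot all_order all_algebra.
From mathcomp Require Import all_classical all_reals all_analysis.
From mathcomp Require Import zify.

Set Implicit Arguments.
Unset Strict Implicit.
Unset Printing Implicit Defensive.

Import Order.TTheory GRing.Theory Num.Theory.
Import numFieldNormedType.Exports.

Local Open Scope classical_set_scope.
Local Open Scope ring_scope.

(** * Smooth scalar functions *)

(** Differentiability depends only on the germ: the first-order expansion of [f] at [x] is also one
    of [g], and uniqueness of the differential identifies ['d g x] with ['d f x]. *)
Lemma near_eq_differentiable (R : numFieldType) (V W : normedModType R)
    (f g : V -> W) (x : V) :
  {near x, f =1 g} -> differentiable f x -> differentiable g x.
Proof.
move=> fg df; have dfc := diff_continuous df.
have gE : g \o shift x = cst (g x) + 'd f x +o_ 0 id.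
  apply/eqaddoP => e e0.
  have /eqaddoP /(_ e e0) := diff_locally df.
  have : \forall h \near 0, f (h + x) = g (h + x).
    by have := fg; rewrite (near_shift 0) subr0.
  apply: filterS2 => h /= fgh.
  by rewrite /= !fctE /= -fgh -(nbhs_singleton fg).
apply/diff_locallyP; rewrite (diff_unique dfc gE); split => //.
Qed.

Section ScalarSmoothness.
Context {R : realType} {n : nat}.
Implicit Types (U : set 'rV[R]_n) (f g : 'rV[R]_n -> R) (x v : 'rV[R]_n).

(* Ck for scalar functions: these can be multiplied and inverted, and
   Cinfty_coord goes back to vector-valued maps coordinatewise. *)
Fixpoint sCk (k : nat) U f : Prop :=
  if k is k'.+1 then
    (forall x, U x -> differentiable f x) /\ (forall v, sCk k' U ('D_v f))
  else forall x, U x -> {for x, continuous f}.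

Definition sCinfty U f := forall k, sCk k U f.

Lemma open_eq_near U f g x : open U -> (forall y, U y -> f y = g y) -> U x ->
  {near x, f =1 g}.
Proof. by move=> oU fg Ux; apply: filterS (open_nbhs_nbhs (conj oU Ux)). Qed.

(** Openness of [U] turns equality on [U] into equality near each of its points, which passes to
    derivatives. Derivation rules that hold only on [U] enter the inductions below through this
    lemma. *)
Lemma sCk_ext k U f g : open U -> (forall x, U x -> f x = g x) ->
  sCk k U f -> sCk k U g.
Proof.
move=> oU; elim: k f g => [|k IHk] f g fg /= => [fc x Ux|[fd fD]].
  have h := open_eq_near oU fg Ux.
  rewrite /prop_for /continuous_at -(fg _ Ux).
  exact: cvg_trans (near_eq_cvg h) (fc x Ux).
split=> [x Ux|v].
  exact: near_eq_differentiable (open_eq_near oU fg Ux) (fd x Ux).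
apply: IHk (fD v) => x Ux.
by apply: near_eq_derive (open_eq_near oU fg Ux).
Qed.

(** The derivative of a product or of an inverse still contains the undifferentiated functions,
    which are then needed at the lower order. *)
Lemma sCk_lower k U f : sCk k.+1 U f -> sCk k U f.
Proof.
elim: k f => [|k IHk] f [fd fD].
  by move=> x Ux; apply: differentiable_continuous; apply: fd.
by split=> // v; apply: IHk.
Qed.

Lemma sCk_cst k U (c : R) : sCk k U (fun=> c).
Proof.
elim: k c => [|k IHk] c; first by move=> x _; apply: cst_continuous.
split=> [x _|v]; first exact: differentiable_cst.
have -> : 'D_v (fun=> c) = fun=> 0 by apply/funext => x; exact: derive_cst.
exact: IHk.
Qed.

Lemma sCk_coord k U i : sCk k U (fun x => x 0 i).
Proof.
case: k => [|k]; first by move=> x _; apply: coord_continuous.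
split=> [x _|v]; first exact: differentiable_coord.
have -> : 'D_v (fun x : 'rV_n => x 0 i) = fun=> v 0 i.
  apply/funext => x.
  have := @derive_mx R 'rV[R]_n 1 n id x v (@derivable_id R _ x v).
  by rewrite derive_id => /matrixP/(_ 0 i); rewrite mxE.
exact: sCk_cst.
Qed.

Lemma sCkD k U f g : open U -> sCk k U f -> sCk k U g ->
  sCk k U (fun x => f x + g x).
Proof.
move=> oU; elim: k f g => [|k IHk] f g /=.
  by move=> fc gc x Ux; apply: continuousD; [exact: fc | exact: gc].
move=> [fd fD] [gd gD]; split=> [x Ux|v].
  by apply: differentiableD; [exact: fd | exact: gd].
apply: sCk_ext (IHk _ _ (fD v) (gD v)) => // x Ux.
by rewrite -deriveD//; apply: diff_derivable; [exact: fd | exact: gd].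
Qed.

Lemma sCkM k U f g : open U -> sCk k U f -> sCk k U g ->
  sCk k U (fun x => f x * g x).
Proof.
move=> oU; elim: k f g => [|k IHk] f g.
  by move=> fc gc x Ux; apply: continuousM; [exact: fc | exact: gc].
move=> Cf Cg; have [fl gl] := (sCk_lower Cf, sCk_lower Cg).
case: Cf Cg => [fd fD] [gd gD]; split=> [x Ux|v].
  by apply: differentiableM; [exact: fd | exact: gd].
apply: sCk_ext (sCkD oU (IHk _ _ fl (gD v)) (IHk _ _ gl (fD v))) => // x Ux.
have := @deriveM _ _ f g x v; rewrite /GRing.scale /= => <- //.
- by apply: diff_derivable; exact: fd.
- by apply: diff_derivable; exact: gd.
Qed.

Lemma sCkV k U f : open U -> (forall x, U x -> f x != 0) -> sCk k U f ->
  sCk k U (fun x => (f x)^-1).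
Proof.
move=> oU f0; elim: k => [|k IHk].
  by move=> fc x Ux; apply: continuousV; [exact: f0 | exact: fc].
move=> Cf; have Vl := IHk (sCk_lower Cf); case: Cf => fd fD; split=> [x Ux|v].
  by apply: differentiableV; [exact: fd | exact: f0].
(* D_v(1/f) = -(1/f)^2 D_v f, where 1/f has order [k] by the induction hypothesis. *)
have := sCkM oU (sCkM oU (sCk_cst k U (-1)) (sCkM oU Vl Vl)) (fD v).
apply: sCk_ext => // x Ux.
have := @deriveV _ _ f x v (f0 _ Ux); rewrite /GRing.scale /= => ->; last first.
  by apply: diff_derivable; exact: fd.
by rewrite mulN1r -invfM -expr2.
Qed.

(** * Closure properties of smooth scalar functions *)

Lemma sCinfty_cst U (c : R) : sCinfty U (fun=> c).
Proof. by move=> k; exact: sCk_cst. Qed.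

Lemma sCinfty_coord U i : sCinfty U (fun x => x 0 i).
Proof. by move=> k; exact: sCk_coord. Qed.

Lemma sCinfty_ext U f g : open U -> (forall x, U x -> f x = g x) ->
  sCinfty U f -> sCinfty U g.
Proof. by move=> oU fg fC k; exact: sCk_ext (fC k). Qed.

Lemma sCinftyD U f g : open U -> sCinfty U f -> sCinfty U g ->
  sCinfty U (fun x => f x + g x).
Proof. by move=> oU fC gC k; exact: sCkD. Qed.

Lemma sCinftyM U f g : open U -> sCinfty U f -> sCinfty U g ->
  sCinfty U (fun x => f x * g x).
Proof. by move=> oU fC gC k; exact: sCkM. Qed.

Lemma sCinftyV U f : open U -> (forall x, U x -> f x != 0) -> sCinfty U f ->
  sCinfty U (fun x => (f x)^-1).
Proof. by move=> oU f0 fC k; exact: sCkV. Qed.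

Lemma sCinfty_sum (I : Type) (r : seq I) (P : pred I) U
    (F : I -> 'rV[R]_n -> R) : open U -> (forall i, sCinfty U (F i)) ->
  sCinfty U (fun x => \sum_(i <- r | P i) F i x).
Proof.
move=> oU FC; elim: r => [|i r IHr].
  by apply: sCinfty_ext (sCinfty_cst U 0) => // x _; rewrite big_nil.
case Pi : (P i); last first.
  by apply: sCinfty_ext IHr => // x _; rewrite big_cons Pi.
by apply: sCinfty_ext (sCinftyD oU (FC i) IHr) => // x _; rewrite big_cons Pi.
Qed.

Lemma sCinfty_prod (I : Type) (r : seq I) (P : pred I) U
    (F : I -> 'rV[R]_n -> R) : open U -> (forall i, sCinfty U (F i)) ->
  sCinfty U (fun x => \prod_(i <- r | P i) F i x).
Proof.
move=> oU FC; elim: r => [|i r IHr].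
  by apply: sCinfty_ext (sCinfty_cst U 1) => // x _; rewrite big_nil.
case Pi : (P i); last first.
  by apply: sCinfty_ext IHr => // x _; rewrite big_cons Pi.
by apply: sCinfty_ext (sCinftyM oU (FC i) IHr) => // x _; rewrite big_cons Pi.
Qed.

(** Each coordinate of [L (F x)] is a combination of the coordinates of [F x], with constant
    coefficients given by [L] on the standard basis. *)
Lemma sCinfty_linear_comp U m p (F : 'rV[R]_n -> 'rV[R]_p)
    (L : {linear 'rV[R]_p -> 'rV[R]_m}) i : open U ->
  (forall j, sCinfty U (fun x => F x 0 j)) -> sCinfty U (fun x => L (F x) 0 i).
Proof.
move=> oU FC.
pose G j x := F x 0 j * L (delta_mx 0 j) 0 i.
apply: (@sCinfty_ext _ (fun x => \sum_j G j x)) => // [x _|].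
  rewrite [in RHS](row_sum_delta (F x)) linear_sum summxE.
  by apply: eq_bigr => j _; rewrite linearZ mxE.
by apply: sCinfty_sum => // j; apply: sCinftyM => //; exact: sCinfty_cst.
Qed.

Lemma sCinfty_linear U m (L : {linear 'rV[R]_n -> 'rV[R]_m}) i : open U ->
  sCinfty U (fun x => L x 0 i).
Proof.
move=> oU; apply: (sCinfty_linear_comp (F := id)) => // j.
exact: sCinfty_coord.
Qed.

Lemma sCinfty_det U m (F : 'rV[R]_n -> 'M[R]_m) : open U ->
  (forall a b, sCinfty U (fun x => F x a b)) -> sCinfty U (fun x => \det (F x)).
Proof.
(* [\det] unfolds to the Leibniz sum over permutations. *)
move=> oU FC; apply: sCinfty_sum => // s; apply: sCinftyM => //.
  exact: sCinfty_cst.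
exact: sCinfty_prod.
Qed.

Lemma sCinfty_invmx U m (F : 'rV[R]_n -> 'M[R]_m) : open U ->
  (forall x, U x -> F x \in unitmx) ->
  (forall a b, sCinfty U (fun x => F x a b)) ->
  forall a b, sCinfty U (fun x => invmx (F x) a b).
Proof.
move=> oU FU FC a b.
(* Cramer's rule; [b] comes before [a] because the adjugate is the transpose of the cofactor
   matrix. *)
pose G x := (\det (F x))^-1 * ((-1) ^+ (b + a) * \det (row' b (col' a (F x)))).
apply: (@sCinfty_ext _ G) => // [x Ux|].
  by rewrite /invmx FU // !mxE.
apply: sCinftyM => //.
  apply: sCinftyV => // [x Ux|]; last exact: sCinfty_det.
  by have := FU _ Ux; rewrite unitmxE unitfE.
apply: sCinftyM => //; first exact: sCinfty_cst.
apply: sCinfty_det => // c d.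
by apply: sCinfty_ext (FC (lift b c) (lift a d)) => // x _; rewrite !mxE.
Qed.

(** Expansion in the standard basis of the target gives differentiability. The coordinates of
    ['D_v f] are the derivatives of those of [f], hence smooth again, so the induction on the order
    goes through. *)
Lemma Cinfty_coord m U (f : 'rV[R]_n -> 'rV[R]_m) : open U ->
  (forall i, sCinfty U (fun x => f x 0 i)) -> Cinfty U f.
Proof.
move=> oU fC k.
have dif (h : 'rV[R]_n -> 'rV[R]_m) : (forall i, sCinfty U (fun x => h x 0 i)) ->
    forall x, U x -> differentiable h x.
  move=> hC x Ux.
  have -> : h = \sum_(i < m) (fun x => h x 0 i *: delta_mx 0 i).
    by apply/funext => y; rewrite fct_sumE [LHS]row_sum_delta.
  apply: differentiable_sum => i; apply: differentiableZl.
  by have [+ _] := hC i 1%N; apply.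
elim: k f fC => [|k IHk] f fC /=.
  by move=> x Ux; apply: differentiable_continuous; exact: dif.
split=> [|v]; first exact: dif.
apply: IHk => i k'; have [_ /(_ v)] := fC i k'.+1.
apply: sCk_ext => // x Ux.
by rewrite derive_mx ?mxE //; apply: diff_derivable; exact: dif.
Qed.

End ScalarSmoothness.

(** * Smooth maps between finite-dimensional spaces *)

Section LinearPair.
Context {R : realType} {X Y Z : lmodType R}.
Context (f : {linear Z -> X}) (h : {linear Z -> Y}).

Definition linear_pair (z : Z) : X * Y := (f z, h z).

Lemma linear_pair_linear : linear linear_pair.
Proof. by move=> a u v; rewrite /linear_pair !linearP. Qed.

HB.instance Definition _ := GRing.isLinear.Build _ _ _ _ linear_pair
  linear_pair_linear.

End LinearPair.

Section SmoothMaps.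
Context {R : realType}.
Implicit Types X Y Z : lmodType R.

Definition findim X : Prop :=
  exists n (c : {linear X -> 'rV[R]_n}), bijective c.

Lemma bij_linear_inverse X Y (c : {linear X -> Y}) : bijective c ->
  exists c' : {linear Y -> X}, cancel c c' /\ cancel c' c.
Proof.
case=> c' cK c'K; have c'_lin : linear c' by exact: can2_linear cK c'K.
pose cM := GRing.isLinear.Build _ _ _ _ _ c'_lin.
by exists (HB.pack c' cM : {linear Y -> X}).
Qed.

Lemma findim_bij X Y (L : {linear X -> Y}) : bijective L -> findim Y -> findim X.
Proof.
move=> Lb [n [c cb]]; exists n, (c \o L : {linear X -> 'rV[R]_n}).
exact: bij_comp.
Qed.

Lemma findim_prod X Y : findim X -> findim Y -> findim (X * Y)%type.
Proof.
case=> n [c /bij_linear_inverse [c' [cK c'K]]].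
case=> m [d /bij_linear_inverse [d' [dK d'K]]].
pose e (p : X * Y) := row_mx (c p.1) (d p.2).
have e_lin : linear e.
  move=> a p q; rewrite /e /= !linearP.
  by rewrite scale_row_mx add_row_mx.
pose eM := GRing.isLinear.Build _ _ _ _ _ e_lin.
exists (n + m)%N, (HB.pack e eM : {linear _ -> _}).
exists (fun x => (c' (lsubmx x), d' (rsubmx x))).
  by case=> x y; rewrite /= /e row_mxKl row_mxKr cK dK.
by move=> x; rewrite /= /e /= c'K d'K hsubmxK.
Qed.

Lemma smooth_on_eq X Y (S : set X) (f h : X -> Y) :
  (forall x, S x -> f x = h x) -> smooth_on S f -> smooth_on S h.
Proof.
move=> fh [n [m [c [d [cb db fS]]]]]; exists n, m, c, d; split=> // x Sx.
have [U [u [oU Ux uC uE]]] := fS x Sx.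
by exists U, u; split=> // y Sy; rewrite -fh //; exact: uE.
Qed.

Lemma smooth_on_linear X Y (S : set X) (L : {linear X -> Y}) :
  findim X -> findim Y -> smooth_on S L.
Proof.
case=> n [c cb] [m [d db]]; exists n, m, c, d; split=> // x _.
have [c' [cK _]] := bij_linear_inverse cb.
(* Read in coordinates, a linear map is already defined and smooth on the whole ambient space,
   whatever [S] is. *)
exists setT, (d \o L \o c'); split=> //; first exact: openT.
  apply: Cinfty_coord; first exact: openT.
  by move=> i; apply: (sCinfty_linear (d \o L \o c') i); exact: openT.
by move=> y _; rewrite /= cK.
Qed.

(** Let [z] be the coordinates of a pair. Expanding only the first argument in the standard basis
    gives a sum of terms z_j times a function linear in [z]. *)
Lemma smooth_on_bilinear X Y Z (S : set (X * Y)) (B : X -> Y -> Z) :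
  (forall x, linear (B x)) -> (forall y, linear (B^~ y)) ->
  findim X -> findim Y -> findim Z -> smooth_on S (fun p => B p.1 p.2).
Proof.
move=> Br Bl Xf Yf [m [d db]]; have [n [c cb]] := findim_prod Xf Yf.
exists n, m, c, d; split=> // x _.
have [c' [cK _]] := bij_linear_inverse cb.
exists setT, (fun x => d (B (c' x).1 (c' x).2)); split=> //; first exact: openT.
  apply: Cinfty_coord; first exact: openT.
  move=> i.
  pose F j (z : 'rV[R]_n) := z 0 j * d (B (c' (delta_mx 0 j)).1 (c' z).2) 0 i.
  have oT : open [set: 'rV[R]_n] by exact: openT.
  apply: (@sCinfty_ext _ _ _ (fun z => \sum_j F j z)) => // [z _|].
    (* Freezing the second argument at [w] leaves a linear map [K], so that only the first
       occurrence of [z] gets expanded. *)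
    rewrite /F; set w := (c' z).2.
    pose M := GRing.isLinear.Build _ _ _ _ _ (Bl w).
    pose L : {linear X -> Z} := HB.pack (B^~ w) M.
    pose K : {linear 'rV[R]_n -> 'rV[R]_m} := d \o L \o fst \o c'.
    rewrite -[RHS]/(K z 0 i) [in RHS](row_sum_delta z) linear_sum summxE.
    by apply: eq_bigr => j _; rewrite linearZ mxE.
  apply: sCinfty_sum => // j; apply: sCinftyM => //; first exact: sCinfty_coord.
  pose M := GRing.isLinear.Build _ _ _ _ _ (Br (c' (delta_mx 0 j)).1).
  pose L : {linear Y -> Z} := HB.pack (B (c' (delta_mx 0 j)).1) M.
  exact: (sCinfty_linear (d \o L \o snd \o c') i).
by move=> y _; rewrite /= cK.
Qed.

(** The single map [e \o f] is a chart around every point, with the whole space as its domain. *)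
Lemma diffeomorphism_submanifold X Y m (S : set X) (T : set Y) (f : X -> Y)
    (e : {linear Y -> 'rV[R]_m}) :
  bijective e -> open (e @` T) -> diffeomorphism S T f -> submanifold m S.
Proof.
move=> eb oT [fb [nX [nY [c [d [cb db fS]]]]]].
move=> [h [mY [mX [c1 [d1 [c1b d1b hS]]]]] hK] x Sx.
have [e' [eK e'K]] := bij_linear_inverse eb.
exists setT, (e @` T), (e \o f); split=> //.
  exists nX, c; split=> //.
  suff -> : c @` setT = setT by exact: openT.
  by apply/seteqP; split=> // y _; case: cb => c' cK c'K; exists (c' y).
rewrite setIT; split.
- have ei : {in T &, injective e} by move=> y z _ _; exact: (bij_inj eb).
  exact: set_bij_comp fb (inj_bij ei).
(* The coordinates [d \o e'] on the target undo [e], so the local extensions for [f] are reused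
   unchanged. *)
- exists nX, nY, c, (d \o e'); split=> //.
    by apply: bij_comp => //; exists e.
  move=> y /fS [U [u [? ? ? uE]]]; exists U, u; split=> // z Sz Uz.
  by rewrite /= eK uE.
- exists (h \o e') => [|y Sy]; last by rewrite /= eK hK.
  exists mY, mX, (c1 \o e'), d1; split=> //.
    by apply: bij_comp => //; exists e.
  move=> _ [y Ty <-] /=; rewrite eK.
  have [U [u [? ? ? uE]]] := hS _ Ty.
  exists U, u; split=> // _ [z Tz <-] /=; rewrite eK; exact: uE.
Qed.

End SmoothMaps.

(** * Products of general linear groups *)

Lemma family_sumE (R : realType) (I : Type) (E : I -> lmodType R) (J : Type)
    (s : seq J) (P : pred J) (F : J -> Defs.family E) i :
  (\sum_(j <- s | P j) F j) i = \sum_(j <- s | P j) F j i.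
Proof. exact: (big_morph (fun x : Defs.family E => x i)). Qed.

Section MatrixFamilies.
Context {R : realType} {I : finType} (r : I -> nat).

Local Notation MF := (Defs.family (fun i => 'M[R]_(r i) : lmodType R)).
Local Notation GL := (carrier (prod_GL (R := R) r)).

(** Positions of the entries in all blocks together. Their number, the sum of the squares of the
    [r i], is the dimension of the group. *)
Let idx := {i : I & ('I_(r i) * 'I_(r i))%type}.

Definition mxfam_row (M : MF) : 'rV[R]_#|{: idx}| :=
  \row_p M (tag (enum_val p)) (tagged (enum_val p)).1 (tagged (enum_val p)).2.

Definition row_mxfam (v : 'rV[R]_#|{: idx}|) : MF :=
  fun i => \matrix_(a, b) v 0 (enum_rank (Tagged _ (a, b) : idx)).

Lemma mxfam_rowK : cancel mxfam_row row_mxfam.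
Proof.
move=> M; apply: functional_extensionality_dep => i.
by apply/matrixP => a b; rewrite !mxE enum_rankK.
Qed.

Lemma row_mxfamK : cancel row_mxfam mxfam_row.
Proof.
move=> v; apply/rowP => p; rewrite !mxE; congr (v 0 _).
apply: (canLR enum_valK); case: (enum_val p) => i [a b] //=.
Qed.

Lemma mxfam_row_linear : linear mxfam_row.
Proof. by move=> a M N; apply/rowP => p; rewrite !mxE. Qed.

HB.instance Definition _ := GRing.isLinear.Build _ _ _ _ mxfam_row mxfam_row_linear.

Lemma row_mxfam_linear : linear row_mxfam.
Proof. exact: can2_linear mxfam_rowK row_mxfamK. Qed.

HB.instance Definition _ := GRing.isLinear.Build _ _ _ _ row_mxfam row_mxfam_linear.

Lemma mxfam_row_bij : bijective mxfam_row.
Proof. by exists row_mxfam; [exact: mxfam_rowK | exact: row_mxfamK]. Qed.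

Lemma findim_mxfam : findim MF.
Proof. exists #|{: idx}|, mxfam_row; exact: mxfam_row_bij. Qed.

Definition mxfam_tr (M : MF) : MF := fun i => (M i)^T.
Definition mxfam_inv (M : MF) : MF := fun i => invmx (M i).

Lemma mxfam_tr_linear : linear mxfam_tr.
Proof.
move=> a M N; apply: functional_extensionality_dep => i.
exact: linearP.
Qed.

HB.instance Definition _ := GRing.isLinear.Build _ _ _ _ mxfam_tr mxfam_tr_linear.

Lemma sCinfty_row_mxfam U i a b : sCinfty U (fun v => row_mxfam v i a b).
Proof.
have -> : (fun v => row_mxfam v i a b) =
    (fun v : 'rV[R]_#|{: idx}| => v 0 (enum_rank (Tagged _ (a, b) : idx))).
  by apply/funext => v; rewrite mxE.
exact: sCinfty_coord.
Qed.

(** The product of all determinants is continuous and is nonzero exactly on the group. *)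
Lemma open_prod_GL : open (mxfam_row @` GL).
Proof.
pose q v := \prod_i \det (row_mxfam v i).
have qC : sCinfty setT q.
  apply: sCinfty_prod => [|i]; first exact: openT.
  by apply: sCinfty_det; [exact: openT | move=> a b; exact: sCinfty_row_mxfam].
have qc : continuous q by move=> v; exact: (qC 0%N).
have -> : mxfam_row @` GL = q @^-1` [set y | y != 0].
  apply/seteqP; split=> [_ [M MU <-]|v /= /prodf_neq0 qv].
    rewrite /= /q; apply/prodf_neq0 => i _.
    by rewrite mxfam_rowK -unitfE -unitmxE; exact: MU.
  exists (row_mxfam v); last exact: row_mxfamK.
  by move=> i; rewrite unitmxE unitfE; exact: qv.
by apply: open_comp => [v _|]; [exact: qc | exact: open_neq].
Qed.

(* This shape covers the inversion of the group (L1 = 0) as well as the inverse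
   of the isomorphism, M |-> (M, (M^-1)^T) in block coordinates. *)
Lemma smooth_on_prod_GL_inv (Y : lmodType R) (L1 L2 : {linear MF -> Y}) :
  findim Y -> smooth_on GL (fun M => L1 M + L2 (mxfam_inv M)).
Proof.
case=> m [d db]; exists #|{: idx}|, m, mxfam_row, d.
split=> // [|M MU]; first exact: mxfam_row_bij.
pose U := mxfam_row @` GL; have oU : open U := open_prod_GL.
exists U, (fun v => d (L1 (row_mxfam v) + L2 (mxfam_inv (row_mxfam v)))).
split=> // [||N _ _]; first by exists M.
- apply: Cinfty_coord => // i.
  pose K1 : {linear 'rV[R]_#|{: idx}| -> 'rV[R]_m} := d \o L1 \o row_mxfam.
  pose K2 : {linear 'rV[R]_#|{: idx}| -> 'rV[R]_m} := d \o L2 \o row_mxfam.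
  (* Flattening the inverted family makes the second summand a linear map applied to a function with
     smooth coordinates. *)
  pose F v := mxfam_row (mxfam_inv (row_mxfam v)).
  apply: (@sCinfty_ext _ _ _ (fun v => K1 v 0 i + K2 (F v) 0 i)) => // [v _|].
    by rewrite /K1 /K2 /F /= mxfam_rowK linearD mxE.
  apply: sCinftyD => //; first exact: sCinfty_linear.
  apply: sCinfty_linear_comp => // p.
  set a := (tagged (enum_val p)).1; set b := (tagged (enum_val p)).2.
  apply: (@sCinfty_ext _ _ _
    (fun v => invmx (row_mxfam v (tag (enum_val p))) a b)) => // [v _|].
    by rewrite mxE.
  apply: sCinfty_invmx => // [_ [N NU <-]|*]; last exact: sCinfty_row_mxfam.
  by rewrite mxfam_rowK; exact: NU.
- by rewrite mxfam_rowK.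
Qed.

Lemma prod_GL_is_group : is_group (prod_GL (R := R) r).
Proof.
split=> /= [i|M N MU NU i|M MU i|M N P _ _ _|M _|M _|M MU|M MU].
- exact: unitmx1.
- by rewrite unitmx_mul MU NU.
- by rewrite unitmx_inv.
- by apply: functional_extensionality_dep => i; rewrite mulmxA.
- by apply: functional_extensionality_dep => i; rewrite mulmx1.
- by apply: functional_extensionality_dep => i; rewrite mul1mx.
- by apply: functional_extensionality_dep => i; rewrite mulmxV.
- by apply: functional_extensionality_dep => i; rewrite mulVmx.
Qed.

Lemma prod_GL_is_lie_group : is_lie_group (prod_GL (R := R) r).
Proof.
split.
- exact: prod_GL_is_group.
- exists #|{: idx}|.
  apply: (@diffeomorphism_submanifold _ _ _ _ _ GL id mxfam_row).
  + exact: mxfam_row_bij.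
  + exact: open_prod_GL.
  + have sid : smooth_on GL (idfun : MF -> MF).
      by apply: smooth_on_linear; exact: findim_mxfam.
    by split=> //; [split=> // M MU; exists M | exists id].
- apply: (@smooth_on_bilinear _ _ _ _ _
    (fun M N : MF => (fun i => M i *m N i) : MF)); try exact: findim_mxfam.
  + move=> M a N P; apply: functional_extensionality_dep => i.
    exact: linearP.
  + move=> M a N P; apply: functional_extensionality_dep => i.
    by rewrite /= mulmxDl -scalemxAl.
- have := smooth_on_prod_GL_inv \0 idfun findim_mxfam.
  congr (smooth_on _ _); apply/funext => M.
  by rewrite /= add0r.
Qed.

End MatrixFamilies.

(** * The orthogonal group of an odd metric *)

Section EndMatrix.
Context {R : realType} {W : vectType R} {m : nat} (s : m.-tuple W).

(** The formula of [matrix_in] with the tuple length decoupled from the space: [tb i] lies in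
    V_{k-(i+1)} but has length [gdim V (k + i)], so [matrix_in] does not apply to it. *)
Definition endmx (A : 'End(W)) : 'M[R]_m :=
  \matrix_(b, a) coord s b (A (tnth s a)).

Lemma endmx_linear : linear endmx.
Proof.
by move=> c A B; apply/matrixP => a b; rewrite !mxE add_lfunE scale_lfunE linearP.
Qed.

Context (s_basis : basis_of fullv s).

Lemma basis_expand v : v = \sum_b coord s b v *: tnth s b.
Proof.
rewrite {1}(coord_basis s_basis (memvf v)).
by apply: eq_bigr => b _; rewrite (tnth_nth 0).
Qed.

Lemma endmxE (A : 'End(W)) a : A (tnth s a) = \sum_b endmx A b a *: tnth s b.
Proof. by rewrite {1}[A _]basis_expand; apply: eq_bigr => b _; rewrite mxE. Qed.

Lemma coord_tnth a b : coord s a (tnth s b) = (a == b)%:R.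
Proof. by rewrite (tnth_nth 0) coord_free ?(basis_free s_basis) // eq_sym. Qed.

Lemma coord_sum_tnth (c : 'I_m -> R) a :
  coord s a (\sum_b c b *: tnth s b) = c a.
Proof.
rewrite linear_sum (bigD1 a) //= linearZ /= coord_tnth eqxx mulr1 big1 ?addr0 //.
by move=> b ba; rewrite linearZ /= coord_tnth eq_sym (negbTE ba) mulr0.
Qed.

Lemma endmx_inj : injective endmx.
Proof.
move=> A B AB; apply/lfunP => v.
rewrite (basis_expand v) !linear_sum; apply: eq_bigr => a _.
by rewrite !linearZ /= !endmxE AB.
Qed.

Lemma endmx1 : endmx \1%VF = 1%:M.
Proof. by apply/matrixP => a b; rewrite !mxE id_lfunE coord_tnth. Qed.

Lemma endmxM A B : endmx (A \o B)%VF = endmx A *m endmx B.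
Proof.
apply/matrixP => a b; rewrite !mxE comp_lfunE endmxE !linear_sum.
by apply: eq_bigr => c _; rewrite !linearZ /= mulrC !mxE.
Qed.

Lemma endmx_surj M : exists A, endmx A = M.
Proof.
pose f v := \sum_b (\sum_a M b a * coord s a v) *: tnth s b.
have f_lin : linear f.
  move=> c u v; rewrite /f scaler_sumr -big_split; apply: eq_bigr => b _ /=.
  rewrite scalerA -scalerDl mulr_sumr -big_split /=; congr (_ *: _).
  by apply: eq_bigr => a _; rewrite linearP mulrDr mulrCA.
pose fM := GRing.isLinear.Build _ _ _ _ _ f_lin.
exists (linfun (HB.pack f fM : {linear W -> W})).
apply/matrixP => b a; rewrite mxE lfunE /= coord_sum_tnth.
rewrite (bigD1 a) //= coord_tnth eqxx mulr1 big1 ?addr0 // => c ca.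
by rewrite coord_tnth (negbTE ca) mulr0.
Qed.

(** The endomorphism with the inverse matrix is a two-sided inverse, since a matrix determines its
    endomorphism. *)
Lemma endmx_unit_bij (A : 'End(W)) : endmx A \in unitmx -> bijective A.
Proof.
move=> Au; have [B BE] := endmx_surj (invmx (endmx A)).
have AB : endmx (A \o B)%VF = endmx \1%VF by rewrite endmxM BE endmx1 mulmxV.
have BA : endmx (B \o A)%VF = endmx \1%VF by rewrite endmxM BE endmx1 mulVmx.
by exists B => v; rewrite -comp_lfunE (endmx_inj AB, endmx_inj BA) id_lfunE.
Qed.

End EndMatrix.

Lemma bij_lker0 (R : realType) (W : vectType R) (A : 'End(W)) :
  bijective A -> lker A == 0%VS.
Proof. by move/bij_inj/lker0P. Qed.

(** * Families supported at one index *)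

Section FamilySingle.
Context {R : realType} {I : eqType} (E : I -> lmodType R) (i0 : I) (x : E i0).

Definition family_single : Defs.family E := fun i =>
  if @eqP _ i0 i is ReflectT e then ecast j (E j) e x else 0.

Lemma family_single_same : family_single i0 = x.
(* Uniqueness of equality proofs in an [eqType] removes the cast. *)
Proof. by rewrite /family_single; case: eqP => // e; rewrite eq_axiomK. Qed.

Lemma family_single_neq i : i0 != i -> family_single i = 0.
Proof. by rewrite /family_single; case: eqP. Qed.

End FamilySingle.

(** * Orthogonality in block coordinates *)

Section OrthogonalGroup.
Context {R : realType} {V : graded_space R} {l k : int} {g : gbilinear V}.
Context {n : nat}.
Context {t : forall i : 'I_n.+1, (gdim V (k + i%:Z)).-tuple (V (k + i%:Z))}.
Context {tb : forall i : 'I_n.+1,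
  (gdim V (k + i%:Z)).-tuple (V (k - (i%:Z + 1)))}.
Context (g_metric : is_metric l g) (lE : l = - (2 * k) + 1).
Context (t_std : is_standard_basis g t tb).

Local Notation r := (fun i : 'I_n.+1 => gdim V (k + i%:Z)).
Local Notation MF := (Defs.family (fun i : 'I_n.+1 => 'M[R]_(r i) : lmodType R)).
Local Notation OG := (orthogonal_group l g).
Local Notation GL := (prod_GL (R := R) r).

(** Linear coordinates on all of [End0 V], in which orthogonality becomes a matrix equation. *)
Definition blocks (A : End0 V) : MF * MF :=
  (fun i => endmx (t i) (A (k + i%:Z)), fun i => endmx (tb i) (A (k - (i%:Z + 1)))).

Lemma blocks_linear : linear blocks.
Proof.
move=> c A B; congr pair; apply: functional_extensionality_dep => i;
  exact: endmx_linear.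
Qed.

HB.instance Definition _ := GRing.isLinear.Build _ _ _ _ blocks blocks_linear.

Let t_basis i : basis_of fullv (t i) := std_basis_t t_std i.
Let tb_basis i : basis_of fullv (tb i) := std_basis_tb t_std i.

Lemma gdim0_eq0 j : gdim V j = 0%N -> forall v : V j, v = 0.
Proof.
rewrite /gdim -dimvf => /eqP; rewrite dimv_eq0 => /eqP V0 v.
by apply/eqP; rewrite -memv0 -V0 memvf.
Qed.

(** Case analysis on a degree. It is phrased with a predicate because [j] occurs in the types of
    vectors and maps, where it cannot simply be rewritten. *)
Lemma degreeP j (P : int -> Prop) :
  (gdim V j = 0%N -> P j) -> (forall i : 'I_n.+1, P (k + i%:Z)) ->
  (forall i : 'I_n.+1, P (k - (i%:Z + 1))) -> P j.
Proof.
move=> P0 Pt Ptb; have [/P0 //|j0] := eqVneq (gdim V j) 0%N.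
by have [i [->|->]] := std_total t_std j0.
Qed.

Lemma blocks_inj : injective blocks.
Proof.
move=> A B AB; apply: functional_extensionality_dep => j.
apply: (@degreeP j (fun j => A j = B j)) => [j0|i|i].
- by apply/lfunP => v; rewrite (gdim0_eq0 j0 v) !linear0.
- apply: (endmx_inj (t_basis i)).
  exact: (congr1 (fun p => p.1 i) AB).
- apply: (endmx_inj (tb_basis i)).
  exact: (congr1 (fun p => p.2 i) AB).
Qed.

(** The preimage is a sum of maps living in one degree each. They do not interfere, as the degrees
    k+i and k-(i'+1) are pairwise distinct. *)
Lemma blocks_surj p : exists A, blocks A = p.
Proof.
pose B i := sval (cid (endmx_surj (t_basis i) (p.1 i))).
pose C i := sval (cid (endmx_surj (tb_basis i) (p.2 i))).
pose E j : lmodType R := 'End(V j).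
exists (\sum_i (@family_single _ _ E _ (B i) + @family_single _ _ E _ (C i))).
rewrite [RHS]surjective_pairing; congr pair;
  apply: functional_extensionality_dep => i.
- rewrite family_sumE (bigD1 i) //= big1 => [|i' i'i].
    rewrite addr0 -[RHS](svalP (cid (endmx_surj (t_basis i) (p.1 i)))).
    congr endmx; rewrite -[RHS]addr0; congr (_ + _).
      exact: family_single_same.
    by apply: family_single_neq; lia.
  rewrite -[RHS]addr0; congr (_ + _); apply: family_single_neq; last by lia.
  by apply: contra i'i => /eqP h; apply/eqP/val_inj => /=; lia.
- rewrite family_sumE (bigD1 i) //= big1 => [|i' i'i].
    rewrite addr0 -[RHS](svalP (cid (endmx_surj (tb_basis i) (p.2 i)))).
    congr endmx; rewrite -[RHS]add0r; congr (_ + _).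
      by apply: family_single_neq; lia.
    exact: family_single_same.
  rewrite -[RHS]addr0; congr (_ + _); apply: family_single_neq; first by lia.
  by apply: contra i'i => /eqP h; apply/eqP/val_inj => /=; lia.
Qed.

Lemma blocks_bij : bijective blocks.
Proof.
have hK p := svalP (cid (blocks_surj p)).
exists (fun p => sval (cid (blocks_surj p))) => [A|p]; last exact: hK.
by apply: blocks_inj; rewrite hK.
Qed.

(** [End0 V] is a family over all integers, but [blocks] identifies it with finitely many
    matrices. *)
Lemma findim_End0 : findim (End0 V).
Proof.
by apply: findim_bij blocks_bij (findim_prod _ _); exact: findim_mxfam.
Qed.

(** Both arguments are expanded in the standard basis; duality of [t i] and [tb i] leaves only the
    diagonal terms of the double sum. *)
Lemma pairing_blocks (A : End0 V) i a b :
  g _ _ (A _ (tnth (t i) a)) (A _ (tnth (tb i) b)) =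
  (((blocks A).1 i)^T *m (blocks A).2 i) a b.
Proof.
rewrite (endmxE (t_basis i)) (endmxE (tb_basis i)) linear_sum mxE.
apply: eq_bigr => c _; rewrite linearZ linear_sum /= sum_lfunE (bigD1 c) //=.
rewrite big1 ?addr0 => [|d dc]; rewrite linearZ scale_lfunE (std_t_tb t_std) eqxx.
  by rewrite eqxx [X in _ *: X]mulr1 [LHS]mulrC !mxE.
(* [std_t_tb] compares the indices as natural numbers, since in general they come from different
   ordinal types. *)
by rewrite -val_eqE in dc; rewrite (negbTE dc) [LHS]mulr0.
Qed.

(** The sign in [gflat] is invertible and cancels. In degree [i] the map [gflat] sees only partners
    of degree -(i+l); for all others both sides vanish. *)
Lemma orthogonal0E (A : End0 V) : orthogonal0 l g A <->
  GL0 A /\ forall i j (v : V i) (w : V j), g i j (A i v) (A j w) = g i j v w.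
Proof.
split=> -[Ab Ag]; split=> //; last first.
  by move=> j v; apply/lfunP => w; rewrite comp_lfunE !scale_lfunE Ag.
move=> i j v w; have [ijl|ijl] := eqVneq (i + j + l) 0; last first.
  by rewrite !(metric_degree g_metric).
have jE : j = - (i + l) by lia.
move: w; rewrite {}jE => w.
have /lfunP/(_ w) := Ag i v; rewrite comp_lfunE !scale_lfunE.
by apply: mulfI; rewrite expfz_neq0 // oppr_eq0 oner_eq0.
Qed.

(** Forward, the equation is invariance tested on basis vectors. Backward, it makes both blocks
    invertible, and invariance extends by bilinearity and a comparison of degrees. *)
Lemma orthogonal0_blocks (A : End0 V) : orthogonal0 l g A <->
  forall i, ((blocks A).1 i)^T *m (blocks A).2 i = 1%:M.
Proof.
rewrite orthogonal0E; split=> [[_ Ag] i|MN].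
  apply/matrixP => a b.
  by rewrite -pairing_blocks Ag (std_t_tb t_std) eqxx mxE.
have At (i : 'I_n.+1) : bijective (A (k + i%:Z)).
  apply: (endmx_unit_bij (t_basis i)).
  by have [] := mulmx1_unit (MN i); rewrite unitmx_tr.
have Atb (i : 'I_n.+1) : bijective (A (k - (i%:Z + 1))).
  by apply: (endmx_unit_bij (tb_basis i)); have [] := mulmx1_unit (MN i).
have Ag (i : 'I_n.+1) v w :
    g (k + i%:Z) (k - (i%:Z + 1)) (A _ v) (A _ w) = g _ _ v w.
  rewrite (basis_expand (t_basis i) v) !linear_sum !sum_lfunE.
  apply: eq_bigr => a _; rewrite !linearZ !scale_lfunE; congr (_ *: _).
  rewrite (basis_expand (tb_basis i) w) !linear_sum.
  apply: eq_bigr => b _; rewrite !linearZ; congr (_ *: _).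
  by rewrite /= pairing_blocks MN (std_t_tb t_std) eqxx mxE.
have Ag' (i i' : 'I_n.+1) v w :
    g (k + i%:Z) (k - (i'%:Z + 1)) (A _ v) (A _ w) = g _ _ v w.
  (* The total degree here, including [l], is i-i', so both sides vanish for distinct indices. *)
  have [ii'|ii'] := eqVneq i i'; first by move: w; rewrite -ii'; exact: Ag.
  by rewrite !(metric_degree g_metric) //; apply: contra ii' => /eqP h;
    apply/eqP/val_inj => /=; lia.
split=> [j|].
  apply: (@degreeP j (fun j => bijective (A j))) => // j0.
  by exists (fun=> 0) => v; rewrite (gdim0_eq0 j0 v) ?linear0.
move=> i; apply: (@degreeP i (fun i => forall j (v : V i) (w : V j),
    g i j (A i v) (A j w) = g i j v w)) => [i0|{}i|{}i] j v w.
- by rewrite (gdim0_eq0 i0 v) !linear0 !zero_lfunE.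
- move: w; apply: (@degreeP j (fun j => forall w : V j,
    g _ j (A _ v) (A j w) = g _ j v w)) => [j0|i'|i'] w; last exact: Ag'.
    by rewrite (gdim0_eq0 j0 w) !linear0.
  (* Total degree i+i'+1, which is never zero; two lower degrees give its negative. *)
  by rewrite !(metric_degree g_metric) //; apply/eqP; lia.
- move: w; apply: (@degreeP j (fun j => forall w : V j,
    g _ j (A _ v) (A j w) = g _ j v w)) => [j0|i'|i'] w.
  + by rewrite (gdim0_eq0 j0 w) !linear0.
  (* The graded symmetry sign depends on the degrees alone, so it is the same before and after
     applying [A]. *)
  + by rewrite [LHS](Defs.metric_sym g_metric) Ag' -(Defs.metric_sym g_metric).
  + by rewrite !(metric_degree g_metric) //; apply/eqP; lia.
Qed.

Lemma orthogonal0_bij (A : End0 V) j : orthogonal0 l g A -> bijective (A j).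
Proof. by case=> + _; apply. Qed.

(** * Group operations in block coordinates *)

Lemma blocks1 : blocks (gone OG) = (gone GL, gone GL).
Proof.
by congr pair; apply: functional_extensionality_dep => i; rewrite endmx1.
Qed.

Lemma blocksM (A B : End0 V) : blocks (gmul OG A B) =
  (gmul GL (blocks A).1 (blocks B).1, gmul GL (blocks A).2 (blocks B).2).
Proof.
by congr pair; apply: functional_extensionality_dep => i; rewrite endmxM.
Qed.

(** Right inverses of a square matrix are unique: the blocks of the inverse and the transposed
    blocks both multiply those of [A] to the identity. *)
Lemma blocksV (A : End0 V) : orthogonal0 l g A -> blocks (ginv OG A) =
  (mxfam_tr (blocks A).2, mxfam_tr (blocks A).1).
Proof.
move=> AO; have MN := (orthogonal0_blocks A).1 AO.
have VA j : (A j \o ginv OG A j)%VF = \1%VF.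
  by apply/lker0_compfV/bij_lker0/orthogonal0_bij.
have inv_uniq m (X Y Z : 'M[R]_m) : X *m Y = 1%:M -> X *m Z = 1%:M -> Y = Z.
  by move=> XY XZ; rewrite -[Z]mul1mx -(mulmx1C XY) -mulmxA XZ mulmx1.
congr pair; apply: functional_extensionality_dep => i.
- apply: (inv_uniq _ (endmx (t i) (A _))).
    by rewrite -endmxM // -(endmx1 (t_basis i)); congr endmx; exact: VA.
  (* M N^T = 1 is the transpose of N M^T = 1, which follows from M^T N = 1 by commuting the
     factors. *)
  by rewrite -[RHS]trmx1 -(mulmx1C (MN i)) trmx_mul trmxK.
- apply: (inv_uniq _ (endmx (tb i) (A _))); last exact: mulmx1C (MN i).
  by rewrite -endmxM // -(endmx1 (tb_basis i)); congr endmx; exact: VA.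
Qed.

Lemma orthogonal_is_group : is_group OG.
Proof.
split=> /= [|A B AO BO|A AO|A B C _ _ _|A _|A _|A AO|A AO].
- apply/orthogonal0_blocks => i; have -> := blocks1.
  by rewrite trmx1 mulmx1.
- apply/orthogonal0_blocks => i; have -> /= := blocksM A B.
  move/orthogonal0_blocks : AO => /(_ i) AO.
  move/orthogonal0_blocks : BO => /(_ i) BO.
  by rewrite trmx_mul -mulmxA (mulmxA (trmx ((blocks A).1 i))) AO mul1mx.
- apply/orthogonal0_blocks => i; have -> /= := blocksV AO.
  by rewrite trmxK; apply: mulmx1C; exact: (orthogonal0_blocks A).1.
- by apply: functional_extensionality_dep => j; rewrite comp_lfunA.
- by apply: functional_extensionality_dep => j; rewrite comp_lfun1r.
- by apply: functional_extensionality_dep => j; rewrite comp_lfun1l.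
- apply: functional_extensionality_dep => j.
  by apply/lker0_compfV/bij_lker0/orthogonal0_bij.
- apply: functional_extensionality_dep => j.
  by apply/lker0_compVf/bij_lker0/orthogonal0_bij.
Qed.

(** Absorbing the transposition into [L2] brings the inverse isomorphism into the shape required by
    [smooth_on_prod_GL_inv]. *)
Lemma blocks_section : exists L1 L2 : {linear MF -> End0 V},
  forall M N, blocks (L1 M + L2 N) = (M, mxfam_tr N).
Proof.
have [P [_ PK]] := bij_linear_inverse blocks_bij.
exists (P \o linear_pair idfun \0), (P \o linear_pair \0 (@mxfam_tr R _ r)) => M N.
by rewrite /= -linearD PK; congr pair; rewrite ?addr0 ?add0r.
Qed.

Lemma orthogonal_blocks_snd (A : End0 V) : orthogonal0 l g A ->
  (blocks A).2 = mxfam_tr (mxfam_inv (blocks A).1).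
Proof.
move=> /orthogonal0_blocks MN; apply: functional_extensionality_dep => i.
have [Mu _] := mulmx1_unit (MN i).
by rewrite /mxfam_tr trmx_inv -[RHS]mulmx1 -(MN i) mulKmx.
Qed.

Lemma blocks_fst_unit (A : End0 V) : orthogonal0 l g A -> carrier GL (blocks A).1.
Proof.
move=> /orthogonal0_blocks MN i.
by have [] := mulmx1_unit (MN i); rewrite unitmx_tr.
Qed.

Lemma orthogonal_diffeomorphism :
  diffeomorphism (carrier OG) (carrier GL) (fun A => (blocks A).1).
Proof.
have [L1 [L2 LE]] := blocks_section.
(* In block coordinates this is M |-> (M, (M^-1)^T); it is defined on all families but inverts the
   isomorphism only on [GL]. *)
pose h M := L1 M + L2 (mxfam_inv M).
have hK A : orthogonal0 l g A -> h (blocks A).1 = A.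
  move=> AO; apply: blocks_inj.
  by rewrite LE -orthogonal_blocks_snd // -surjective_pairing.
have hO M : carrier GL M -> orthogonal0 l g (h M).
  move=> MU; apply/orthogonal0_blocks => i; rewrite LE /=.
  by rewrite -trmx_mul mulVmx ?trmx1 //; exact: MU.
split.
- split=> [A|A B|M MU]; first exact: blocks_fst_unit.
    by move=> /set_mem AO /set_mem BO AB; rewrite -(hK A) // AB hK.
  by exists (h M); [exact: hO | rewrite LE].
- exact: (smooth_on_linear _ (fst \o blocks) findim_End0 (findim_mxfam _)).
- by exists h => //; exact: smooth_on_prod_GL_inv findim_End0.
Qed.

Lemma orthogonal_is_lie_group : is_lie_group OG.
Proof.
split.
- exact: orthogonal_is_group.
(* The dimension is fixed by the flattening [mxfam_row] of the target. *)
- eexists; apply: diffeomorphism_submanifold orthogonal_diffeomorphism.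
    exact: mxfam_row_bij.
  exact: open_prod_GL.
- apply: (@smooth_on_bilinear _ _ _ _ _ (gmul OG)); try exact: findim_End0.
  + move=> A c B C; apply: functional_extensionality_dep => j.
    by rewrite /= comp_lfunDr -comp_lfunZr.
  + move=> A c B C; apply: functional_extensionality_dep => j.
    by rewrite /= comp_lfunDl -comp_lfunZl.
- have [P [PK _]] := bij_linear_inverse blocks_bij.
  (* On the group, inversion agrees with this linear map, which swaps and transposes the two
     blocks. *)
  apply: (smooth_on_eq (f := P \o
    linear_pair (@mxfam_tr R _ r \o snd) (@mxfam_tr R _ r \o fst) \o blocks)).
    by move=> A AO; exact: (canLR PK (esym (blocksV AO))).
  by apply: smooth_on_linear; exact: findim_End0.
Qed.

End OrthogonalGroup.

Theorem proposition10p4 (R : realType) (V : graded_space R) (l k : int)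
    (g : gbilinear V) (i_max : nat)
    (t : forall i : 'I_i_max.+1, (gdim V (k + i%:Z)).-tuple (V (k + i%:Z)))
    (tb : forall i : 'I_i_max.+1, (gdim V (k + i%:Z)).-tuple (V (k - (i%:Z + 1))))
    (V_neq0 : exists j, gdim V j != 0%N)
    (g_metric : is_metric l g)
    (lE : l = - (2 * k) + 1)
    (r_neq0 : gdim V (k + i_max%:Z) != 0%N)
    (r_eq0 : forall i : nat, (i_max < i)%N -> gdim V (k + i%:Z) = 0%N)
    (t_std : is_standard_basis g t tb) :
  lie_group_isomorphism (orthogonal_group l g)
    (prod_GL (fun i : 'I_i_max.+1 => gdim V (k + i%:Z)))
    (fun A i => matrix_in (t i) (A (k + i%:Z))).
Proof.
split.
- exact: orthogonal_is_lie_group g_metric lE t_std.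
- exact: prod_GL_is_lie_group.
(* [matrix_in (t i)] is convertible to [endmx (t i)], so the results on blocks apply directly. *)
- move=> A B _ _; apply: functional_extensionality_dep => i.
  exact: (endmxM (std_basis_t t_std i)).
- exact: orthogonal_diffeomorphism g_metric lE t_std.
Qed.
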